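(* Let $X$ be a topological space and let $(S,* )$ be a semigroup (under composition) of functions in $C(X,X)$, the continuous functions $X\to X$, together with an involution $*:S\to S$. Suppose that $\phi\in Z(S)$ is an aperiodic injective function and that $P^{+,*}(X,S)$ is nonempty. Then, for any $\ell\ge 2$, $$P^{+,*}(X,S,\mathbb{C}^{\ell})\subsetneq P^{+,*}_{proj}(X,S,\mathbb{C}^{\ell}).$$
   Context: A kernel $K:X\times X\to M_\ell(\mathbb{C})$ is positive definite if for all finitely many distinct points $x_1,\dots,x_n\in X$ and vectors $v_1,\dots,v_n\in\mathbb{C}^\ell$ one has $\sum_{\mu,\nu=1}^n\langle K(x_\mu,x_\nu)v_\mu,v_\nu\rangle\ge 0$; it is strictly positive definite if moreover the inequality is strict whenever at least one $v_\mu$ is nonzero. For $v\in\mathbb{C}^\ell\setminus\{0\}$, the scalar valued projection of $K$ is the scalar kernel $K_v(x,y)=\langle K(x,y)v,v\rangle$. Scalar kernels are the case $\ell=1$. An involution on a set $Z$ is a map $*:Z\to Z$, $z\mapsto z^*$, with $(z^* )^*=z$ for every $z\in Z$. A kernel $K$ is adjointly invariant by $(S,* )$ if $K(x,\phi(y))=K(\phi^{*}(x),y)$ for all $x,y\in X$ and $\phi\in S$. $P^{+,*}(X,S,\mathbb{C}^\ell)$ is the set of continuous kernels $K:X\times X\to M_\ell(\mathbb{C})$ that are adjointly invariant by $(S,* )$ and strictly positive definite; $P^{+,*}(X,S):=P^{+,*}(X,S,\mathbb{C}^1)$. $P^{+,*}_{proj}(X,S,\mathbb{C}^\ell)$ is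 the set of continuous kernels $K:X\times X\to M_\ell(\mathbb{C})$ that are adjointly invariant by $(S,* )$ and such that $K_v$ is strictly positive definite for every $v\in\mathbb{C}^\ell\setminus\{0\}$. $Z(S)=\{\phi\in S:\phi\psi=\psi\phi\text{ for all }\psi\in S\}$ is the center of $S$. A function $\phi:X\to X$ is aperiodic if $\phi^m(x)\ne x$ for all $x\in X$ and all integers $m\ge 1$, where $\phi^m$ is the $m$-fold composition. *)

(* Defs.v *)
From HB Require Import structures.
From mathcomp Require Import all_boot all_order all_algebra.
From mathcomp Require Import all_classical all_reals all_analysis.
From mathcomp Require Import complex.

Set Implicit Arguments.
Unset Strict Implicit.
Unset Printing Implicit Defensive.

Import Order.TTheory GRing.Theory Num.Theory.
Import numFieldNormedType.Exports.

Local Open Scope classical_set_scope.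
Local Open Scope ring_scope.

(* R[i] carries the topology given by the modulus; 'M[R[i]]_l then gets the
   entrywise topology of the library. *)
HB.instance Definition _ (R : realType) := PseudoMetric.copy R[i] (R[i])^o.

(* Linear in the first argument. *)
Definition inner (R : realType) (l : nat) (u w : 'cV[R[i]]_l) : R[i] :=
  \sum_(i < l) u i 0 * Num.conj (w i 0).

Definition kernel (R : realType) (X : Type) (l : nat) := X -> X -> 'M[R[i]]_l.

Definition quad_form (R : realType) (X : Type) (l : nat) (K : kernel R X l)
    (n : nat) (x : 'I_n -> X) (v : 'I_n -> 'cV[R[i]]_l) : R[i] :=
  \sum_(mu < n) \sum_(nu < n) inner (K (x mu) (x nu) *m v mu) (v nu).

(* On R[i], [0 <= z] (resp. [0 < z]) says that z is real and nonnegative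
   (resp. positive). *)
Definition positive_definite (R : realType) (X : Type) (l : nat)
    (K : kernel R X l) : Prop :=
  forall (n : nat) (x : 'I_n -> X) (v : 'I_n -> 'cV[R[i]]_l),
    injective x -> 0 <= quad_form K x v.

Definition strictly_positive_definite (R : realType) (X : Type) (l : nat)
    (K : kernel R X l) : Prop :=
  positive_definite K /\
  forall (n : nat) (x : 'I_n -> X) (v : 'I_n -> 'cV[R[i]]_l),
    injective x -> (exists mu, v mu != 0) -> 0 < quad_form K x v.

(* Scalar kernels are kernels with values in 1 x 1 matrices. *)
Definition projection (R : realType) (X : Type) (l : nat) (K : kernel R X l)
    (v : 'cV[R[i]]_l) : kernel R X 1 :=
  fun x y => (inner (K x y *m v) v)%:M.

Definition continuous_kernel (R : realType) (X : topologicalType) (l : nat)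
    (K : kernel R X l) : Prop :=
  continuous (fun p : X * X => K p.1 p.2).

(* [star : S -> S] is a map of the subtype of elements of S. *)
Definition adjointly_invariant (R : realType) (X : Type) (l : nat)
    (S : set (X -> X)) (star : S -> S) (K : kernel R X l) : Prop :=
  forall (phi : S) (x y : X), K x (val phi y) = K (val (star phi) x) y.

Definition composition_semigroup (X : Type) (S : set (X -> X)) : Prop :=
  forall phi psi, S phi -> S psi -> S (phi \o psi).

Definition composition_center (X : Type) (S : set (X -> X)) : set (X -> X) :=
  [set phi | S phi /\ forall psi, S psi -> phi \o psi = psi \o phi].

Definition aperiodic (X : Type) (phi : X -> X) : Prop :=
  forall (x : X) (m : nat), (1 <= m)%N -> iter m phi x <> x.

Definition Pplus (R : realType) (X : topologicalType) (S : set (X -> X))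
    (star : S -> S) (l : nat) : set (kernel R X l) :=
  [set K | [/\ continuous_kernel K, adjointly_invariant star K
             & strictly_positive_definite K]].

Definition Pplus_proj (R : realType) (X : topologicalType) (S : set (X -> X))
    (star : S -> S) (l : nat) : set (kernel R X l) :=
  [set K | [/\ continuous_kernel K, adjointly_invariant star K
             & forall v : 'cV[R[i]]_l, v != 0 ->
                 strictly_positive_definite (projection K v)]].

Arguments Pplus R {X S} star l.
Arguments Pplus_proj R {X S} star l.

(* Main.v *)
(* Let k be a scalar kernel in P^+, and let K be the matrix kernel with entries
   K_ij(x, y) = k(phi^j x, phi^i y).  Its quadratic form at points x_mu and
   vectors v_mu is the form of k at the finitely supported measure
   sum_{mu, j} v_mu(j) delta_{phi^j x_mu}.  This measure vanishes for the points
   phi x, x and the vectors e_0, -e_1, so K is not strictly positive definite.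
   For the projection along v it is the image of sum_mu c_mu delta_{x_mu} under
   the polynomial sum_j v(j) phi_*^j, which is injective on finitely supported
   measures since phi is injective and aperiodic: if d is the degree and x a
   point of the support whose orbit never meets the support again, the mass at
   phi^d x is v(d) times the mass at x.  Adjoint invariance of K uses that phi
   is central. *)
Require Import Defs.
From mathcomp Require Import all_boot all_order all_algebra.
From mathcomp Require Import all_classical all_reals all_analysis.
From mathcomp Require Import complex.

Set Implicit Arguments.
Unset Strict Implicit.
Unset Printing Implicit Defensive.

Import Order.TTheory GRing.Theory Num.Theory.

Local Open Scope classical_set_scope.
Local Open Scope ring_scope.

(** * Continuity into matrices and of iterates *)

Lemma cvg_mx (T : topologicalType) (m n : nat) (Y : Type)
    (F : set_system Y) (FF : Filter F) (f : Y -> 'M[T]_(m, n))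
    (M : 'M[T]_(m, n)) :
  (forall i j, (fun y => f y i j) @ F --> M i j) -> f @ F --> M.
Proof.
move=> cvf A [P nP sPA].
apply: (filterS (P := fun y => forall i j, P i j (f y i j))).
  by move=> y Py; apply: sPA.
by do 2![apply: filter_forall => ?]; exact: cvf (nP _ _).
Qed.

Lemma continuous_coord (T : topologicalType) (m n : nat) (i : 'I_m) (j : 'I_n) :
  continuous (fun M : 'M[T]_(m, n) => M i j).
Proof.
move=> M A nA.
exists (fun i' j' => if (i' == i) && (j' == j) then A else setT).
  move=> i' j'; case: ifP => [/andP[/eqP-> /eqP->] //|_]; exact: filterT.
by move=> N /(_ i j) /=; rewrite !eqxx.
Qed.

Lemma continuous_iter (X : topologicalType) (f : X -> X) (n : nat) :
  continuous f -> continuous (iter n f).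
Proof.
move=> cf; elim: n => [|n IH] x /=; first exact: cvg_id.
apply: (@continuous_comp _ _ _ (iter n f) f); [exact: IH | exact: cf].
Qed.

Lemma iter_inj (X : Type) (f : X -> X) (n : nat) :
  injective f -> injective (iter n f).
Proof. by move=> f_inj; elim: n => [|n IH] x y //= /f_inj /IH. Qed.

(** * Forms at finitely supported measures *)

(* Unlike [quad_form], this allows repeated points: only the sums of [a] over
   the fibres of [p] matter. *)
Definition hform (R : realType) (X : Type) (T : finType) (K : Defs.kernel R X 1)
    (p : T -> X) (a : T -> R[i]) : R[i] :=
  \sum_s \sum_t K (p s) (p t) 0 0 * a s * Num.conj (a t).

Lemma factor_through_distinct_points (X : choiceType) (T : finType)
    (p : T -> X) :
  exists n (x : 'I_n -> X) (q : T -> 'I_n), injective x /\ p =1 x \o q.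
Proof.
pose s := undup (codom p); pose x := tnth (in_tuple s).
have qP t : exists i, p t == x i.
  have /seq_tnthP[i pi] : p t \in s by rewrite mem_undup codom_f.
  by exists i; rewrite pi.
exists (size s), x, (fun t => xchoose (qP t)); split.
  by apply/tuple_uniqP; exact: undup_uniq.
by move=> t; apply/eqP; exact: xchooseP (qP t).
Qed.

(** Masses placed at the same point add up: both sums are split over the fibres of [q], on which the
    kernel value is constant. *)
Lemma hform_quad_form (R : realType) (X : Type) (T : finType)
    (K : Defs.kernel R X 1) (n : nat) (x : 'I_n -> X) (q : T -> 'I_n)
    (p : T -> X) (a : T -> R[i]) : p =1 x \o q ->
  hform K p a = quad_form K x (fun i => (\sum_(t | q t == i) a t)%:M).
Proof.
move=> pE; rewrite /hform /quad_form (partition_big q predT) //=.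
apply: eq_bigr => i _.
rewrite exchange_big (partition_big q predT) //=; apply: eq_bigr => j _.
rewrite /inner big_ord1 !mxE big_ord1 !mxE eqxx !mulr1n.
rewrite rmorph_sum mulr_sumr; apply: eq_bigr => t /eqP <-.
rewrite mulr_sumr mulr_suml; apply: eq_bigr => s /eqP <-.
by rewrite !pE.
Qed.

Lemma hform_ge0 (R : realType) (X : choiceType) (T : finType)
    (K : Defs.kernel R X 1) (p : T -> X) (a : T -> R[i]) :
  positive_definite K -> 0 <= hform K p a.
Proof.
move=> Kpd; have [n [x [q [x_inj pE]]]] := factor_through_distinct_points p.
by rewrite (hform_quad_form _ _ pE); exact: Kpd.
Qed.

Lemma hform_gt0 (R : realType) (X : choiceType) (T : finType)
    (K : Defs.kernel R X 1) (p : T -> X) (a : T -> R[i]) (y : X) :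
  strictly_positive_definite K -> \sum_(t | p t == y) a t != 0 ->
  0 < hform K p a.
Proof.
move=> [_ Kspd] ay.
have [n [x [q [x_inj pE]]]] := factor_through_distinct_points p.
rewrite (hform_quad_form _ _ pE); apply: Kspd => //.
have [t0 /eqP pt0 _] : exists2 t, p t == y & a t != 0.
  apply: contrapT => no; move/eqP: ay; apply; apply: big1 => t pt.
  by apply: contrapT => /eqP at0; apply: no; exists t.
(* Injectivity of [x] makes the fibre of [q] over [q t0] equal to the fibre of [p] over [y], so the
   two masses agree. *)
exists (q t0); apply: contra_neq ay => /matrixP/(_ 0 0).
rewrite !mxE eqxx mulr1n => qt0; rewrite -[RHS]qt0; apply: eq_bigl => t.
by rewrite -pt0 !pE /= (inj_eq x_inj).
Qed.

Lemma quad_form_projection (R : realType) (X : Type) (l : nat)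
    (K : Defs.kernel R X l) (w : 'cV[R[i]]_l) (n : nat) (x : 'I_n -> X)
    (c : 'I_n -> 'cV[R[i]]_1) :
  quad_form (projection K w) x c = quad_form K x (fun mu => c mu 0 0 *: w).
Proof.
rewrite /quad_form; apply: eq_bigr => mu _; apply: eq_bigr => nu _.
rewrite /inner big_ord1 !mxE big_ord1 !mxE eqxx !mulr1n 2!mulr_suml.
apply: eq_bigr => i _; rewrite -scalemxAr !mxE rmorphM.
by rewrite -mulrA mulrACA [c mu 0 0 * _]mulrC [X in _ = _ * X]mulrC.
Qed.

(** Since [w] is nonzero, a nonzero scalar times [w] is a nonzero test vector for [K]. This gives
    the inclusion half of the theorem. *)
Lemma projection_spd (R : realType) (X : Type) (l : nat) (K : Defs.kernel R X l)
    (w : 'cV[R[i]]_l) :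
  w != 0 -> strictly_positive_definite K ->
  strictly_positive_definite (projection K w).
Proof.
move=> w0 [Kpd Kspd]; split=> n x c x_inj.
  by rewrite quad_form_projection; exact: Kpd.
move=> [mu cmu]; rewrite quad_form_projection; apply: Kspd => //.
exists mu; rewrite scaler_eq0 negb_or w0 andbT.
by apply: contra_neq cmu => c0; apply/matrixP => i j; rewrite !ord1 c0 mxE.
Qed.

(** * The orbit kernel *)

(** The column index [j] goes with [x] because in [inner (K x y *m v) w] it is paired with [v], the
    vector attached to [x]. *)
Definition orbit_kernel (R : realType) (X : Type) (l : nat) (phi : X -> X)
    (K : Defs.kernel R X 1) : Defs.kernel R X l :=
  fun x y => \matrix_(i, j) K (iter j phi x) (iter i phi y) 0 0.

Lemma quad_form_orbit_kernel (R : realType) (X : Type) (l : nat)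
    (phi : X -> X) (K : Defs.kernel R X 1) (n : nat) (x : 'I_n -> X)
    (v : 'I_n -> 'cV[R[i]]_l) :
  quad_form (orbit_kernel l phi K) x v =
  hform K (fun s : 'I_n * 'I_l => iter s.2 phi (x s.1)) (fun s => v s.1 s.2 0).
Proof.
pose F mu (j : 'I_l) nu (i : 'I_l) :=
  K (iter j phi (x mu)) (iter i phi (x nu)) 0 0 *
  v mu j 0 * Num.conj (v nu i 0).
transitivity (\sum_mu \sum_j \sum_nu \sum_i F mu j nu i); last first.
  rewrite pair_bigA; apply: eq_bigr => s _.
  by rewrite pair_bigA.
apply: eq_bigr => mu _; rewrite [RHS]exchange_big; apply: eq_bigr => nu _.
rewrite [RHS]exchange_big; apply: eq_bigr => i _; rewrite mxE mulr_suml.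
by apply: eq_bigr => j _; rewrite mxE.
Qed.

Lemma orbit_kernel_continuous (R : realType) (X : topologicalType) (l : nat)
    (phi : X -> X) (K : Defs.kernel R X 1) :
  continuous phi -> continuous_kernel K ->
  continuous_kernel (orbit_kernel l phi K).
Proof.
move=> cphi cK p; apply: cvg_mx => i j.
under eq_fun do rewrite mxE.
rewrite mxE.
apply: (@continuous_comp _ _ _
  (fun p : X * X => K (iter j phi p.1) (iter i phi p.2))
  (fun M : 'M[R[i]]_1 => M 0 0)); last exact: continuous_coord.
apply: (@continuous_comp _ _ _
  (fun p : X * X => (iter j phi p.1, iter i phi p.2))
  (fun p => K p.1 p.2)); last exact: cK.
apply: cvg_pair.
  apply: (@continuous_comp _ _ _ fst (iter j phi)); first exact: cvg_fst.
  exact: continuous_iter.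
apply: (@continuous_comp _ _ _ snd (iter i phi)); first exact: cvg_snd.
exact: continuous_iter.
Qed.

Lemma orbit_kernel_adjointly_invariant (R : realType) (X : Type) (l : nat)
    (S : set (X -> X)) (star : S -> S) (phi : X -> X) (K : Defs.kernel R X 1) :
  composition_center S phi -> adjointly_invariant star K ->
  adjointly_invariant star (orbit_kernel l phi K).
Proof.
move=> [_ phiC] Kinv psi x y.
(* Used for both [psi] and [star psi]. *)
have iterC (n : nat) (chi : S) z :
    iter n phi (val chi z) = val chi (iter n phi z).
  elim: n => //= n ->.
  have /(congr1 (@^~ (iter n phi z))) := phiC _ (set_valP chi).
  exact.
by apply/matrixP => i j; rewrite !mxE !iterC Kinv.
Qed.

(** * Strict positivity of the projections *)

(** Reachability by a positive number of steps is transitive, and irreflexive by aperiodicity, so a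
    finite nonempty set has a maximal element. It is found by minimizing the number of
    successors. *)
Lemma exists_last_visit (X : choiceType) (phi : X -> X) (n : nat)
    (x : 'I_n -> X) (P : pred 'I_n) (mu0 : 'I_n) :
  aperiodic phi -> P mu0 ->
  exists2 mu, P mu &
    forall m nu, (0 < m)%N -> P nu -> iter m phi (x mu) <> x nu.
Proof.
move=> phi_ap Pmu0.
pose r mu nu := `[< exists2 m, (0 < m)%N & iter m phi (x mu) = x nu >].
case: (@arg_minnP _ mu0 P (fun mu => #|[set nu | P nu & r mu nu]%SET|) Pmu0)
  => mu Pmu mu_min.
exists mu => // m nu m0 Pnu mu_nu; have := mu_min _ Pnu; apply/negP.
rewrite -ltnNge; apply: proper_card; apply/properP; split.
  apply/fintype.subsetP => xi; rewrite !inE.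
  move=> /andP[-> /asboolP[m' m'0 nu_xi]] /=.
  by apply/asboolP; exists (m' + m)%N; rewrite ?addn_gt0 ?m'0 // iterD mu_nu.
(* Properness: [nu] succeeds [mu] but not itself. *)
exists nu; first by rewrite inE Pnu; apply/asboolP; exists m.
by rewrite inE Pnu; apply/asboolP => -[m' m'0]; exact: phi_ap.
Qed.

Lemma orbit_sum_neq0 (F : fieldType) (X : choiceType) (phi : X -> X) (l n : nat)
    (x : 'I_n -> X) (c : 'I_n -> F) (w : 'cV[F]_l) (mu0 : 'I_n) :
  aperiodic phi -> injective phi -> injective x -> c mu0 != 0 -> w != 0 ->
  exists y, \sum_(s : 'I_n * 'I_l | iter s.2 phi (x s.1) == y)
    c s.1 * w s.2 0 != 0.
Proof.
move=> phi_ap phi_inj x_inj cmu0 /cV0Pn[j0 wj0].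
have [mu cmu mu_last] :=
  @exists_last_visit X phi n x (fun mu => c mu != 0) mu0 phi_ap cmu0.
case: (@arg_maxnP _ j0 (fun j => w j 0 != 0) (@nat_of_ord l) wj0) => d wd d_max.
exists (iter d phi (x mu)); rewrite (bigD1 (mu, d)) //= big1 ?addr0.
  by rewrite mulf_neq0.
(* Were this other term nonzero, then [j <= d], and cancelling [iter j phi] would give
   [x nu = iter (d - j) phi (x mu)]. The choice of [mu] forces [j = d], hence [nu = mu]. *)
move=> [nu j] /= /andP[/eqP nu_mu /negP ne]; apply/eqP; rewrite mulf_eq0.
apply: contrapT => /negP; rewrite negb_or => /andP[cnu wj].
have jd : (j <= d)%N by exact: d_max.
move: nu_mu; rewrite -(subnKC jd) iterD => /(iter_inj phi_inj) nu_mu.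
have [dj0|/mu_last/(_ cnu)] := posnP (d - j)%N; last first.
  by move=> /(_ (esym nu_mu)).
apply: ne; rewrite xpair_eqE; apply/andP; split.
  by apply/eqP/x_inj; rewrite nu_mu dj0.
by rewrite -val_eqE /= eqn_leq jd /= -subn_eq0 dj0.
Qed.

Lemma orbit_kernel_projection_spd (R : realType) (X : choiceType) (l : nat)
    (phi : X -> X) (K : Defs.kernel R X 1) (w : 'cV[R[i]]_l) :
  aperiodic phi -> injective phi -> w != 0 -> strictly_positive_definite K ->
  strictly_positive_definite (projection (orbit_kernel l phi K) w).
Proof.
move=> phi_ap phi_inj w0 Kspd; split=> n x c x_inj.
  rewrite quad_form_projection quad_form_orbit_kernel.
  exact: hform_ge0 Kspd.1.
move=> [mu cmu]; rewrite quad_form_projection quad_form_orbit_kernel.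
have cmu0 : c mu 0 0 != 0.
  by apply: contra_neq cmu => c0; apply/matrixP => i j; rewrite !ord1 c0 mxE.
have [y sy] := @orbit_sum_neq0 _ X phi l n x (fun mu => c mu 0 0) w mu
  phi_ap phi_inj x_inj cmu0 w0.
apply: (@hform_gt0 _ _ _ _ _ _ y Kspd).
by under eq_bigr do rewrite mxE.
Qed.

(** * Failure of strict positivity *)

Lemma hform_collision (R : realType) (X : Type) (T : finType)
    (K : Defs.kernel R X 1) (p : T -> X) (s0 s1 : T) : p s0 = p s1 ->
  hform K p (fun s => (s == s0)%:R - (s == s1)%:R) = 0.
Proof.
move=> p01; rewrite /hform exchange_big big1 //= => t _.
rewrite -mulr_suml; under eq_bigr do rewrite mulrBr.
have sum_delta u : \sum_s K (p s) (p t) 0 0 * (s == u)%:R = K (p u) (p t) 0 0.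
  rewrite (bigD1 u) //= eqxx mulr1 big1 ?addr0 // => s /negbTE ->.
  exact: mulr0.
by rewrite sumrB !sum_delta p01 subrr mul0r.
Qed.

Lemma orbit_kernel_not_spd (R : realType) (X : Type) (l : nat)
    (phi : X -> X) (K : Defs.kernel R X 1) (x : X) :
  (2 <= l)%N -> phi x <> x ->
  ~ strictly_positive_definite (orbit_kernel l phi K).
Proof.
move=> l2 phix [_ spd].
pose y (i : 'I_2) := if i == 0 then phi x else x.
pose j0 := Ordinal (ltnW l2); pose j1 := Ordinal l2.
(* The two opposite masses both sit at [phi x], reached as [iter 0 phi (phi x)] and as
   [iter 1 phi x]. *)
pose a (s : 'I_2 * 'I_l) : R[i] := (s == (0, j0))%:R - (s == (1, j1))%:R.
pose v mu : 'cV[R[i]]_l := \col_j a (mu, j).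
have y_inj : injective y.
  rewrite /y => i j; case: eqVneq => [->|i0]; case: eqVneq => [->|j0'] //.
  - by move=> /esym.
  - by move=> _; apply: val_inj; move: i j i0 j0' => [[|[|i]] ?] [[|[|j]] ?].
have v0 : v 0 != 0.
  apply/cV0Pn; exists j0; rewrite mxE /a !xpair_eqE !eqxx /=.
  by rewrite subr0 oner_neq0.
have := spd _ y v y_inj (ex_intro _ 0 v0).
rewrite quad_form_orbit_kernel.
have -> : (fun s : 'I_2 * 'I_l => v s.1 s.2 0) = a.
  by apply: funext => -[mu j]; rewrite mxE.
by rewrite hform_collision // ltxx.
Qed.

Theorem theorem3p4 (R : realType) (X : topologicalType)
  (X_nonempty : [set: X] !=set0)
  (S : set (X -> X))
  (S_semigroup : composition_semigroup S)
  (S_continuous : forall psi : X -> X, S psi -> continuous psi)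
  (star : S -> S) (star_involution : involutive star)
  (phi : X -> X) (phi_center : composition_center S phi)
  (phi_aperiodic : aperiodic phi) (phi_injective : injective phi)
  (Pplus_nonempty : Pplus R star 1 !=set0)
  (l : nat) (l_ge2 : (2 <= l)%N) :
  Pplus R star l `<` Pplus_proj R star l.
Proof.
split=> [K [cK invK spdK]|sub].
  by split=> // w w0; exact: projection_spd.
have [k [ck invk spdk]] := Pplus_nonempty; have [x _] := X_nonempty.
(* [sub] is the reverse inclusion, to be refuted by this kernel. *)
have [_ _] : Pplus R star l (orbit_kernel l phi k).
  apply: sub; split.
  - exact: orbit_kernel_continuous (S_continuous _ phi_center.1) ck.
  - exact: orbit_kernel_adjointly_invariant.
  - by move=> w w0; exact: orbit_kernel_projection_spd.
by apply: (orbit_kernel_not_spd (x := x)) => //; exact: (phi_aperiodic x 1).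
Qed.
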